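(* Let $H$ be a complex Hilbert space and let $\mathcal{E}(H)$ be the set of all effects on $H$. Let $\phi : \mathcal{E}(H)\to \mathcal{E}(H)$ be a bijective map with the property that \[ E \leq F \Longleftrightarrow \phi(E)\leq\phi(F) \qquad (E,F \in \mathcal{E}(H)) \] and suppose that there are states $D$, $D'$ on $H$ such that \[ \operatorname{tr}(\phi(E)D')=\operatorname{tr}(ED) \qquad (E\in \mathcal{E}(H)). \] Then there exists an either unitary or antiunitary operator $U$ on $H$ such that $\phi$ is of the form \[ \phi(E)=UEU^{*} \qquad (E\in \mathcal{E}(H)). \]
   Context: An effect on a complex Hilbert space $H$ is a self-adjoint bounded linear operator $E$ on $H$ with $0\leq E\leq I$, where $I$ is the identity operator; $\mathcal{E}(H)$ denotes the set of all effects. The relation $\leq$ is the usual order among self-adjoint bounded operators ($E\leq F$ iff $F-E$ is positive, i.e. positive semidefinite), restricted to $\mathcal{E}(H)$. A (mixed) state on $H$ is a positive trace-class operator on $H$ with trace $1$; $\operatorname{tr}$ is the usual trace functional. An antiunitary operator is a conjugate-linear bijection $U$ of $H$ preserving the norm; its adjoint $U^*$ is $U^{-1}$. *)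

(* Defs.v *)
From HB Require Import structures.
From mathcomp Require Import all_boot all_order all_algebra.
From mathcomp Require Import sesquilinear.
From mathcomp Require Import finmap.
From mathcomp Require Import all_classical all_reals all_analysis.
From mathcomp.analysis.showcase Require Import summability.
From mathcomp Require Import complex.

Set Implicit Arguments.
Unset Strict Implicit.
Unset Printing Implicit Defensive.

Import Order.TTheory GRing.Theory Num.Theory.
Import numFieldNormedType.Exports.

Local Open Scope classical_set_scope.
Local Open Scope ring_scope.

(* R[i] packed as a numClosedFieldType, so that it inherits the norm topology
   that MathComp-Analysis puts on every numFieldType. *)
Definition complexes (R : realType) : numClosedFieldType := R[i].

(* The inner product is linear in its first argument and conjugate-linear in
   the second; completeness and the norm come from completeNormedModType. *)
HB.mixin Record CompleteNormedModule_isHilbert (C : numClosedFieldType) H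
    & CompleteNormedModule C H := {
  hdot : {dot H for Num.conj} ;
  hdot_norm : forall x : H, hdot x x = `|x| ^+ 2
}.

#[short(type="hilbertType")]
HB.structure Definition Hilbert (C : numClosedFieldType) :=
  {H of CompleteNormedModule_isHilbert C H & CompleteNormedModule C H}.

Section Operators.
Context {C : numClosedFieldType} {H : hilbertType C}.
Implicit Types (A B D E S T U V : H -> H).

Definition bounded_op T : Prop :=
  linear T /\ exists M : C, forall x, `|T x| <= M * `|x|.

Definition is_adjoint T S : Prop := forall x y, hdot (T x) y = hdot x (S y).

Definition self_adjoint T : Prop := bounded_op T /\ is_adjoint T T.

(* In a numClosedFieldType, 0 <= z says that z is real and nonnegative. *)
Definition positive_op T : Prop :=
  self_adjoint T /\ forall x, 0 <= hdot (T x) x.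

Definition op_le A B : Prop := positive_op (B \- A).

Definition effects : set (H -> H) :=
  [set E | [/\ self_adjoint E, op_le (fun=> 0) E & op_le E id]].

Definition orthonormal_basis (B : set H) : Prop :=
  (forall x y, B x -> B y -> hdot x y = (x == y)%:R) /\
  (forall x, (forall e, B e -> hdot x e = 0) -> x = 0).

(* No separability is assumed: the sum over a basis is the limit of the
   partial sums along the net of its finite subsets. *)
Definition has_trace T (c : C) : Prop :=
  forall B : set H, orthonormal_basis B ->
    partial_sum (fun e : set_type B => hdot (T (val e)) (val e)) @ totally --> c.

(* The value common to all orthonormal bases; 0 is a junk value, taken only when
   there is no such value. *)
Definition trace T : C := xget 0 [set c | has_trace T c].

(* P is the positive square root of T^* T. *)
Definition is_abs T P : Prop :=
  positive_op P /\ exists2 S, is_adjoint T S & P \o P = S \o T.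

Definition trace_class T : Prop :=
  bounded_op T /\ exists2 P, is_abs T P & exists c, has_trace P c.

Definition state D : Prop :=
  [/\ positive_op D, trace_class D & trace D = 1].

Definition unitary_with_adjoint U V : Prop :=
  [/\ bounded_op U, is_adjoint U V, cancel U V & cancel V U].

(* For antiunitary U the adjoint is the inverse. *)
Definition antiunitary_with_adjoint U V : Prop :=
  [/\ forall (a : C) x y, U (a *: x + y) = a^* *: U x + U y,
      forall x, `|U x| = `|x|, cancel U V & cancel V U].

End Operators.

(* Main.v *)
Require Import Defs.
From mathcomp Require Import all_boot all_order all_algebra.
From mathcomp Require Import all_classical all_reals all_analysis.
From mathcomp Require Import sesquilinear finmap complex ring.
From mathcomp.analysis.showcase Require Import summability.

Set Implicit Arguments.
Unset Strict Implicit.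
Unset Printing Implicit Defensive.

Import Order.TTheory GRing.Theory Num.Theory.
Import numFieldNormedType.Exports.

(** Write |v><v| for the operator x -> <x, v> v, an effect when |v| <= 1. The effects
    of rank at most one are those below which the effects form a chain, and the
    rank-one projections are maximal among them; so phi maps rank-one effects to
    rank-one effects and rank-one projections to rank-one projections. The same
    holds for the dual map E -> 1 - phi (1 - E), which is again an order
    automorphism and satisfies the same trace condition.

    By Parseval the trace condition on |v><v| says that the quadratic form
    q v = <Dv, v> is transported to that of D'. Being homogeneous, it makes phi
    homogeneous on the multiples of a projection |x><x| with q x <> 0
    ([order_automorphism_scale]), and likewise for the dual map. Whether a multiple
    of |x><x| is below the complement of a multiple of |y><y| depends only on the
    scalars and on the transition probability |<x, y>|^2, and determines the latter
    ([rank_one_le_compl_half]). Hence phi and its dual act on the rays with q <> 0 by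
    one and the same map, which preserves transition probabilities
    ([order_automorphism_transition]).

    The form q may have a kernel. If e is a unit vector of the range of D, then
    q x <> 0 for every x not orthogonal to e ([exists_off_kernel]). A version of
    Wigner's theorem that only needs the rays off the hyperplane e^perp
    ([wigner_off_hyperplane]) yields a linear or conjugate-linear onto isometry U
    such that phi and its dual map |v><v| to |Uv><Uv| for all such v.

    Finally an effect E with <Ee, e> <> 0 is determined by the operators |v><v| <= E
    with v not orthogonal to e ([effect_eq_off_hyperplane]), because
    |Ex><Ex| / <Ex, x> is below E and agrees with E at x, and a perturbation of x
    along e reaches the remaining x. So phi E = U E U^* for such E. For the others
    <(1 - E)e, e> <> 0, and the same argument applies to the dual map. *)

Local Open Scope classical_set_scope.
Local Open Scope ring_scope.

(** * The inner product *)

Section InnerProduct.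
Context {C : numClosedFieldType} {H : hilbertType C}.
Implicit Types (x y z u v w : H) (a b c : C).

Lemma hdotDl x y z : hdot (x + y) z = hdot x z + hdot y z.
Proof. exact: linearDl. Qed.
Lemma hdotDr x y z : hdot z (x + y) = hdot z x + hdot z y.
Proof. exact: linearDr. Qed.
Lemma hdotBl x y z : hdot (x - y) z = hdot x z - hdot y z.
Proof. exact: linearBl. Qed.
Lemma hdotBr x y z : hdot z (x - y) = hdot z x - hdot z y.
Proof. exact: linearBr. Qed.
Lemma hdotZl a x y : hdot (a *: x) y = a * hdot x y.
Proof. by rewrite linearZl_LR. Qed.
Lemma hdotZr a x y : hdot x (a *: y) = a^* * hdot x y.
Proof. by rewrite linearZr_LR. Qed.
Lemma hdotZZ a x : hdot (a *: x) (a *: x) = `|a| ^+ 2 * hdot x x.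
Proof. by rewrite hdotZl hdotZr mulrA normCK. Qed.
Lemma hdot0l x : hdot 0 x = 0.
Proof. exact: linear0l. Qed.
Lemma hdot0r x : hdot x 0 = 0.
Proof. exact: linear0r. Qed.
Lemma hdotC x y : (hdot x y)^* = hdot y x.
Proof. by rewrite (hermC hdot y x) expr0 mul1r. Qed.

Lemma hdot_ge0 x : 0 <= hdot x x.
Proof. by rewrite hdot_norm exprn_ge0. Qed.

Lemma hdot_eq0 x : (hdot x x == 0) = (x == 0).
Proof. by rewrite hdot_norm sqrf_eq0 normr_eq0. Qed.

Lemma hdot_ext x y : (forall z, hdot x z = hdot y z) -> x = y.
Proof.
move=> h; apply/eqP; rewrite -subr_eq0 -hdot_eq0 hdotBl !hdotBr !h.
by rewrite subrr.
Qed.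

End InnerProduct.

(** * Positive forms and effects *)

Section FormInequality.
Context {C : numClosedFieldType} {H : hilbertType C}.
Implicit Types (x y z u v w : H) (a b c : C) (E F T : H -> H).

Lemma linear_D T x y : linear T -> T (x + y) = T x + T y.
Proof. by move=> lT; rewrite -[x in LHS]scale1r lT scale1r. Qed.

Lemma linear_0 T : linear T -> T 0 = 0.
Proof.
by move=> lT; have := linear_D 0 0 lT; rewrite addr0 => /eqP;
  rewrite -subr_eq0 opprD addrA subrr sub0r oppr_eq0 => /eqP.
Qed.

Lemma linear_Z T a x : linear T -> T (a *: x) = a *: T x.
Proof. by move=> lT; rewrite -[a *: x]addr0 lT (linear_0 lT) addr0. Qed.

Lemma adjoint_formC T x y : is_adjoint T T -> (hdot (T x) y)^* = hdot (T y) x.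
Proof. by move=> aT; rewrite hdotC -aT. Qed.

Lemma formD T x y : linear T -> is_adjoint T T ->
  hdot (T (x + y)) (x + y) =
  hdot (T x) x + hdot (T y) y + (hdot (T x) y + (hdot (T x) y)^*).
Proof.
move=> lT aT; rewrite (linear_D _ _ lT) hdotDl !hdotDr (adjoint_formC _ _ aT).
by ring.
Qed.

Lemma formZ T a x : linear T ->
  hdot (T (a *: x)) (a *: x) = `|a| ^+ 2 * hdot (T x) x.
Proof. by move=> lT; rewrite (linear_Z _ _ lT) hdotZl hdotZr normCK; ring. Qed.

(** Expanding the form at x - t g y, with g = <Tx, y> and t real, gives a quadratic
    in t that stays nonnegative; t = 1 / <Ty, y> is its minimum. *)
Lemma form_cauchy_schwarz T : linear T -> is_adjoint T T ->
  (forall x, 0 <= hdot (T x) x) ->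
  forall x y, `|hdot (T x) y| ^+ 2 <= hdot (T x) x * hdot (T y) y.
Proof.
move=> lT aT pT x y; set g := hdot (T x) y.
set a := hdot (T x) x; set b := hdot (T y) y.
have ra : a \is Num.real by exact: ger0_real (pT x).
have key t : t \is Num.real -> 0 <= a - t * `|g| ^+ 2 *+ 2 + t ^+ 2 * `|g| ^+ 2 * b.
  move=> /conj_Creal tR; have := pT (x + (- (t * g)) *: y).
  rewrite formD// formZ// hdotZr -/a -/b -/g normrN normrM exprMn !normCK.
  rewrite tR !rmorphM !rmorphN !rmorphM /= !conjCK tR.
  by congr (0 <= _); ring.
have [b0|b0] := eqVneq b 0.
  have [->|g0] := eqVneq g 0; first by rewrite normr0 expr0n mulr_ge0 ?pT.
  have g20 : `|g| ^+ 2 != 0 by rewrite sqrf_eq0 normr_eq0.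
  (* for a null y the expression is affine in t and would become negative *)
  have := key ((a + 1) / `|g| ^+ 2).
  rewrite rpredM ?rpredV ?rpredX ?normr_real ?rpredD ?rpred1// => /(_ isT).
  rewrite b0 mulr0 addr0 divfK// mulr2n.
  have -> : a - (a + 1 + (a + 1)) = - (a + (1 + 1)) by ring.
  rewrite oppr_ge0 => h; exfalso.
  by have := lt_le_trans (ltr_wpDl (pT x) (@ltr0Sn C 1)) h; rewrite ltxx.
have bp : 0 < b by rewrite lt_def b0 pT.
have := key b^-1; rewrite rpredV (ger0_real (pT y)) => /(_ isT).
have -> : a - b^-1 * `|g| ^+ 2 *+ 2 + b^-1 ^+ 2 * `|g| ^+ 2 * b
        = a - `|g| ^+ 2 / b by field.
by rewrite subr_ge0 ler_pdivrMr.
Qed.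

Lemma cauchy_schwarz x y : `|hdot x y| ^+ 2 <= hdot x x * hdot y y.
Proof. exact: (@form_cauchy_schwarz id) (@hdot_ge0 _ _) x y. Qed.

Lemma form_null T x : linear T -> is_adjoint T T ->
  (forall x, 0 <= hdot (T x) x) -> hdot (T x) x = 0 -> T x = 0.
Proof.
move=> lT aT pT x0; apply: hdot_ext => z; rewrite hdot0l; apply/eqP.
have := form_cauchy_schwarz lT aT pT x z; rewrite x0 mul0r.
by rewrite -normrX normr_le0 sqrf_eq0.
Qed.

End FormInequality.

Section Effects.
Context {C : numClosedFieldType} {H : hilbertType C}.
Implicit Types (x y z u v w : H) (a b c : C) (E F T A B : H -> H).

Lemma self_adjoint_id : self_adjoint (id : H -> H).
Proof.
by split=> //; split=> //; exists 1 => x; rewrite mul1r.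
Qed.

Lemma self_adjoint0 : self_adjoint (fun=> 0 : H).
Proof.
split; last by move=> x y; rewrite hdot0l hdot0r.
split; first by move=> a x y; rewrite scaler0 addr0.
by exists 0 => x; rewrite normr0 mul0r.
Qed.

Lemma self_adjointB A B : self_adjoint A -> self_adjoint B ->
  self_adjoint (A \- B).
Proof.
move=> [[lA [M hM]] aA] [[lB [N hN]] aB]; split; last first.
  by move=> x y /=; rewrite hdotBl hdotBr aA aB.
split; first by move=> a x y /=; rewrite lA lB scalerBr opprD addrACA.
exists (M + N) => x /=; rewrite mulrDl.
by rewrite (le_trans (ler_normB _ _))// lerD.
Qed.

(** Boundedness comes for free from the bounds on the form; so effects can be
    built and compared through their quadratic forms alone. *)
Lemma effectP E : effects E <->
  [/\ linear E, is_adjoint E E & forall x, 0 <= hdot (E x) x <= hdot x x].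
Proof.
split.
  case=> -[[lE bE] aE] [_ h0] [_ h1]; split=> // x.
  by have := h0 x; have := h1 x; rewrite /= subr0 hdotBl subr_ge0 => -> ->.
case=> lE aE h; have pE x : 0 <= hdot (E x) x by case/andP: (h x).
have qE x : hdot (E x) x <= hdot x x by case/andP: (h x).
(* Cauchy-Schwarz for the form of E gives |Ex|^4 <= |x|^2 |Ex|^2. *)
have bE x : `|E x| <= 1 * `|x|.
  rewrite mul1r; have [->|Ex0] := eqVneq (E x) 0; first by rewrite normr0.
  have Exp : 0 < `|E x| ^+ 2 by rewrite exprn_gt0// normr_gt0.
  rewrite -(@ler_pXn2r _ 2)// ?nnegrE// -(ler_pM2r Exp) -expr2.
  have := form_cauchy_schwarz lE aE pE x (E x).
  rewrite hdot_norm normrX normr_id => /le_trans; apply.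
  by rewrite -!hdot_norm ler_pM.
have sE : self_adjoint E by split=> //; split=> //; exists 1.
split=> //; split=> [|x /=].
- exact: self_adjointB self_adjoint0.
- by rewrite subr0.
- exact: self_adjointB self_adjoint_id _.
- by rewrite hdotBl subr_ge0.
Qed.

Lemma effect_leP E F : effects E -> effects F ->
  op_le E F <-> forall x, hdot (E x) x <= hdot (F x) x.
Proof.
move=> -[sE _ _] [sF _ _]; split=> [[_ h] x|h].
  by have := h x; rewrite /= hdotBl subr_ge0.
by split=> [|x /=]; [exact: self_adjointB | rewrite hdotBl subr_ge0].
Qed.

Lemma effect_ext E F : effects E -> effects F ->
  (forall x, hdot (E x) x = hdot (F x) x) -> E = F.
Proof.
move=> /effectP[lE aE _] /effectP[lF aF _] h; apply/funext => x.
pose T := F \- E; have T0 z : hdot (T z) z = 0 by rewrite /T /= hdotBl h subrr.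
have lT : linear T by move=> a u v; rewrite /T /= lE lF scalerBr opprD addrACA.
have aT : is_adjoint T T by move=> u v; rewrite /T /= hdotBl hdotBr aE aF.
have /eqP := form_null lT aT (fun z => eq_ind_r (>= 0) (lexx 0) (T0 z)) (T0 x).
by rewrite subr_eq0 => /eqP.
Qed.

Lemma op_le_anti E F : effects E -> effects F -> op_le E F -> op_le F E -> E = F.
Proof.
move=> eE eF /effect_leP-/(_ eE eF) EF /effect_leP-/(_ eF eE) FE.
by apply: effect_ext => // x; apply/eqP; rewrite eq_le EF FE.
Qed.

Definition effect_compl E : H -> H := fun x => x - E x.

Lemma effect_complK E : effect_compl (effect_compl E) = E.
Proof. by apply/funext => x; rewrite /effect_compl subKr. Qed.

Lemma effects_compl E : effects E -> effects (effect_compl E).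
Proof.
move=> /effectP[lE aE h]; apply/effectP; split.
- by move=> a x y; rewrite /effect_compl lE scalerBr opprD addrACA.
- by move=> x y; rewrite /effect_compl hdotBl hdotBr aE.
- by move=> x; rewrite hdotBl subr_ge0 lerBlDr lerDl andbC; case/andP: (h x) => -> ->.
Qed.

Lemma op_le_compl E F : op_le (effect_compl E) (effect_compl F) <-> op_le F E.
Proof.
rewrite /op_le; suff -> : effect_compl F \- effect_compl E = E \- F by [].
by apply/funext => x; rewrite /= /effect_compl opprB addrC subrKA.
Qed.

End Effects.

(** * Rank-one effects and the order *)

Section RankOne.
Context {C : numClosedFieldType} {H : hilbertType C}.
Implicit Types (x y z u v w : H) (a b c : C) (E F T A B : H -> H).

Definition rank_one v : H -> H := fun x => hdot x v *: v.

Lemma rank_oneE v x : hdot (rank_one v x) x = `|hdot x v| ^+ 2.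
Proof. by rewrite hdotZl normCK hdotC. Qed.

Lemma rank_one_scale v a : `|a| = 1 -> rank_one (a *: v) = rank_one v.
Proof.
move=> a1; apply/funext=> x; rewrite /rank_one hdotZr scalerA.
by rewrite mulrAC [a^* * a]mulrC -normCK a1 expr1n mul1r.
Qed.

Lemma effects_rank_one v : hdot v v <= 1 -> effects (rank_one v).
Proof.
move=> v1; apply/effectP; split.
- by move=> a x y; rewrite /rank_one hdotDl hdotZl scalerDl scalerA.
- by move=> x y; rewrite hdotZl hdotZr hdotC mulrC.
move=> x; rewrite rank_oneE exprn_ge0//= (le_trans (cauchy_schwarz _ _))//.
by rewrite -[leRHS]mulr1 ler_wpM2l// hdot_ge0.
Qed.

Lemma hdot_gt0 v : (0 < hdot v v) = (v != 0).
Proof. by rewrite lt_def hdot_ge0 andbT hdot_eq0. Qed.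

(** Every z orthogonal to w is orthogonal to v, so v lies on the line of w. *)
Lemma rank_one_leP v w :
  (forall x, hdot (rank_one v x) x <= hdot (rank_one w x) x) ->
  exists2 c, `|c| <= 1 & v = c *: w.
Proof.
move=> h; have vw x : `|hdot x v| <= `|hdot x w|.
  by rewrite -(@ler_pXn2r _ 2)// ?nnegrE// -!rank_oneE.
have perp z : hdot z w = 0 -> hdot z v = 0.
  by move=> zw; have := vw z; rewrite zw normr0 normr_le0 => /eqP.
have [w0|w0] := eqVneq w 0.
  exists 0; first by rewrite normr0.
  by apply/eqP; rewrite scale0r -hdot_eq0 perp// w0 hdot0r.
have ww : hdot w w != 0 by rewrite hdot_eq0.
pose c := hdot v w / hdot w w; pose z := v - c *: w.
have zw : hdot z w = 0 by rewrite hdotBl hdotZl divfK// subrr.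
have vE : v = c *: w.
  apply/eqP; rewrite -subr_eq0 -hdot_eq0 -/z {2}/z hdotBr hdotZr zw mulr0 subr0.
  by rewrite perp.
exists c => //; have := vw w; rewrite vE hdotZr normrM norm_conjC.
by rewrite -ler_pdivlMr ?normr_gt0// divff// normr_eq0.
Qed.

(** The normalization makes the form of the rank-one operator agree with that of E
    at x. *)
Definition below_at E x : H := (sqrtC (hdot (E x) x))^-1 *: E x.

Lemma below_atE E x y : effects E ->
  hdot (rank_one (below_at E x) y) y = `|hdot (E x) y| ^+ 2 / hdot (E x) x.
Proof.
move=> /effectP[lE aE h]; have /andP[pE _] := h x.
rewrite rank_oneE hdotZr normrM norm_conjC exprMn normfV exprVn.
rewrite -(normrX 2 (sqrtC _)) sqrtCK.
by rewrite (ger0_norm pE) mulrC -[in LHS]hdotC norm_conjC.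
Qed.

(** This is Cauchy-Schwarz for the form of E; it replaces the usual argument through
    the square root of E. *)
Lemma below_at_le E x y : effects E -> hdot (E x) x != 0 ->
  hdot (rank_one (below_at E x) y) y <= hdot (E y) y.
Proof.
move=> eE x0; rewrite below_atE//; move: eE => /effectP[lE aE h].
have pE z : 0 <= hdot (E z) z by case/andP: (h z).
rewrite ler_pdivrMr ?lt_def ?x0 ?pE// mulrC.
exact: form_cauchy_schwarz.
Qed.

Lemma below_at_eq E x : effects E -> hdot (E x) x != 0 ->
  hdot (rank_one (below_at E x) x) x = hdot (E x) x.
Proof.
move=> eE x0; rewrite below_atE//; move: eE => /effectP[lE aE h].
by have /andP[pE _] := h x; rewrite (ger0_norm pE) expr2 mulfK.
Qed.

Lemma hdot_below_at E x : effects E -> hdot (E x) x != 0 ->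
  hdot (below_at E x) (below_at E x) <= 1.
Proof.
move=> eE x0; set v := below_at E x.
have h : hdot (rank_one v v) v <= hdot v v.
  rewrite (le_trans (below_at_le _ eE x0))//.
  by move: eE => /effectP[_ _ /(_ v)/andP[]].
move: h; rewrite rank_oneE (ger0_norm (hdot_ge0 v)) expr2.
have [->|v0] := eqVneq v 0; first by rewrite hdot0l ler01.
by rewrite -ler_pdivlMr ?hdot_gt0// divff// hdot_eq0.
Qed.

(** This property, invariant under order automorphisms, characterizes the effects
    of rank at most one. *)
Definition chain_below E := forall A B, effects A -> effects B ->
  op_le A E -> op_le B E -> op_le A B \/ op_le B A.

(** A kills the orthogonal complement of v, because its form vanishes there. *)
Lemma below_rank_one v A : effects A ->
  (forall x, hdot (A x) x <= hdot (rank_one v x) x) ->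
  exists2 t, t \is Num.real & forall x, hdot (A x) x = t * `|hdot x v| ^+ 2.
Proof.
move=> /effectP[lA aA h] Av; have pA y : 0 <= hdot (A y) y by case/andP: (h y).
have A0 z : hdot z v = 0 -> A z = 0.
  move=> zv; apply: form_null => //; apply/eqP; rewrite eq_le pA andbT.
  by rewrite (le_trans (Av z))// rank_oneE zv normr0 expr0n.
exists (hdot (A v) v / hdot v v ^+ 2).
  by rewrite rpredM// ?rpredV ?rpredX// ger0_real ?hdot_ge0.
move=> x; have [v0|v0] := eqVneq v 0.
  move: A0; rewrite v0 => A0.
  by rewrite (A0 x) ?hdot0r ?hdot0l// normr0 expr0n mulr0.
have vv : hdot v v != 0 by rewrite hdot_eq0.
pose c := hdot x v / hdot v v; pose z := x - c *: v.
have /A0 z0 : hdot z v = 0 by rewrite hdotBl hdotZl divfK// subrr.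
have -> : x = c *: v + z by rewrite /z addrC subrK.
rewrite formD// z0 hdot0l addr0 (aA _ z) z0 hdot0r conjC0 !addr0 formZ//.
rewrite hdotDl hdotZl /z hdotBl hdotZl /c divfK// subrr addr0.
by rewrite !normrM normfV (ger0_norm (hdot_ge0 v)); field.
Qed.

Lemma chain_below_rank_one v : hdot v v <= 1 -> chain_below (rank_one v).
Proof.
move=> /effects_rank_one ev A B eA eB /effect_leP-/(_ eA ev) Av.
move=> /effect_leP-/(_ eB ev) Bv.
have [s sR As] := below_rank_one eA Av; have [t tR Bt] := below_rank_one eB Bv.
have /orP[st|ts] := real_leVge sR tR; [left|right]; apply/effect_leP => // x.
  by rewrite As Bt ler_wpM2r// exprn_ge0.
by rewrite As Bt ler_wpM2r// exprn_ge0.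
Qed.

(** If the effects below E form a chain, the rank-one effects below E built from
    x and from y are comparable, which forces equality in Cauchy-Schwarz. *)
Lemma chain_below_rank1 E : effects E -> chain_below E ->
  exists2 v, hdot v v <= 1 & E = rank_one v.
Proof.
move=> eE ch; case: (pselect (exists x, hdot (E x) x != 0)); last first.
  move=> /forallNP E0; exists 0; first by rewrite hdot0l ler01.
  apply: effect_ext => // [|x]; first by apply: effects_rank_one; rewrite hdot0l ler01.
  by rewrite rank_oneE hdot0r normr0 expr0n; apply/eqP; have /negP/negPn := E0 x.
move=> [x x0]; exists (below_at E x); first exact: hdot_below_at.
have below y : hdot (E y) y != 0 -> effects (rank_one (below_at E y)).
  by move=> y0; apply: effects_rank_one; exact: hdot_below_at.
have belowE y : hdot (E y) y != 0 -> op_le (rank_one (below_at E y)) E.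
  move=> y0; apply/effect_leP => [|//|z]; first exact: below.
  exact: below_at_le.
have ev := below _ x0.
apply: effect_ext => // y; apply/eqP; rewrite eq_le below_at_le// andbT.
move/effectP: (eE) => [lE aE hE].
have pE z : 0 <= hdot (E z) z by case/andP: (hE z).
have [y0|y0] := eqVneq (hdot (E y) y) 0.
  by rewrite y0 rank_oneE exprn_ge0.
have ew := below _ y0.
have [] := ch _ _ ev ew (belowE _ x0) (belowE _ y0).
- move=> /effect_leP-/(_ ev ew) /(_ x); rewrite below_at_eq// !below_atE//.
  rewrite !ler_pdivlMr ?lt_def ?x0 ?y0 ?pE// mulrC => /le_trans; apply.
  by rewrite aE -[in leLHS]hdotC norm_conjC.
- by move=> /effect_leP-/(_ ew ev) /(_ y); rewrite below_at_eq.
Qed.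

End RankOne.

(** * Comparing effects through rank-one operators *)

Section Determination.
Context {C : numClosedFieldType} {H : hilbertType C}.
Implicit Types (x y z u v w e : H) (a b c t : C) (E F T A B : H -> H).

Lemma rank_one_range_le E y : effects E ->
  (forall x, hdot (rank_one (E y) x) x <= hdot (E x) x) <-> hdot (E y) y <= 1.
Proof.
move=> /effectP[lE aE h]; have pE z : 0 <= hdot (E z) z by case/andP: (h z).
have eq x : hdot (rank_one (E y) x) x = `|hdot (E y) x| ^+ 2.
  by rewrite rank_oneE -[hdot x _]hdotC norm_conjC.
split=> [/(_ y)|y1 x]; rewrite eq.
  rewrite ger0_norm// expr2; have [->|y0] := eqVneq (hdot (E y) y) 0.
    by rewrite ler01.
  by rewrite -ler_pdivlMr ?lt_def ?y0 ?pE// divff.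
by rewrite (le_trans (form_cauchy_schwarz lE aE pE _ _))// ler_piMl.
Qed.

(** This is [rank_one_range_le] for the complement of [rank_one v], whose inverse
    is explicit when v is shorter than 1. *)
Lemma rank_one_le_compl v w : hdot v v < 1 ->
  (forall x, hdot (rank_one w x) x <= hdot (effect_compl (rank_one v) x) x) <->
  hdot w w + `|hdot w v| ^+ 2 / (1 - hdot v v) <= 1.
Proof.
move=> v1; have nv : 1 - hdot v v != 0 by rewrite subr_eq0 eq_sym lt_eqF.
have eE : effects (effect_compl (rank_one v)).
  by apply/effects_compl/effects_rank_one/ltW.
pose y := w + (hdot w v / (1 - hdot v v)) *: v.
have yE : effect_compl (rank_one v) y = w.
  rewrite /effect_compl /rank_one /y hdotDl hdotZl.
  have -> : hdot w v + hdot w v / (1 - hdot v v) * hdot v v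
          = hdot w v / (1 - hdot v v) by field.
  by rewrite addrK.
have := rank_one_range_le y eE; rewrite yE /y hdotDr hdotZr.
suff -> : (hdot w v / (1 - hdot v v))^* * hdot w v
        = `|hdot w v| ^+ 2 / (1 - hdot v v) by [].
by rewrite rmorphM fmorphV rmorphB rmorph1 /= (hdotC v v) normCK; ring.
Qed.

Lemma rank_one_le_compl_orth x y : hdot x x = 1 -> hdot y y = 1 ->
  (forall z, hdot (rank_one x z) z <= hdot (effect_compl (rank_one y) z) z) <->
  hdot x y = 0.
Proof.
move=> x1 y1; split=> [/(_ x)|xy].
  rewrite rank_oneE hdotBl rank_oneE x1 normr1 expr1n lerBrDr gerDl.
  by rewrite -normrX normr_le0 sqrf_eq0 => /eqP.
have eE : effects (effect_compl (rank_one y)).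
  by apply/effects_compl/effects_rank_one; rewrite y1.
have xE : effect_compl (rank_one y) x = x.
  by rewrite /effect_compl /rank_one xy scale0r subr0.
by have [_] := rank_one_range_le x eE; rewrite xE x1; apply.
Qed.

(** The order between the multiples of one projection and the complement of half
    of another one determines their transition probability. *)
Lemma rank_one_le_compl_half x y t : hdot x x = 1 -> hdot y y = 1 ->
  (forall z, hdot (rank_one (t *: x) z) z <=
             hdot (effect_compl (rank_one (sqrtC 2^-1 *: y)) z) z) <->
  `|t| ^+ 2 * (1 + `|hdot x y| ^+ 2) <= 1.
Proof.
move=> x1 y1; have s2 : `|sqrtC 2^-1 : C| ^+ 2 = 2^-1.
  by rewrite -normrX sqrtCK ger0_norm// invr_ge0 ler0n.
have n2 : (2 : C) != 0 by rewrite pnatr_eq0.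
rewrite rank_one_le_compl.
  rewrite !hdotZl !hdotZr x1 y1 !normrM !norm_conjC !exprMn s2 !mulr1 -!normCK s2.
  suff -> : `|t| ^+ 2 + `|t| ^+ 2 * (2^-1 * `|hdot x y| ^+ 2) / (1 - 2^-1)
          = `|t| ^+ 2 * (1 + `|hdot x y| ^+ 2) by [].
  have -> : 1 - 2^-1 = 2^-1 :> C by field.
  by field.
by rewrite hdotZl hdotZr y1 mulr1 -normCK s2 invf_lt1 ?ltr1n ?ltr0n.
Qed.

(** A substitute for letting t tend to 0, adapted to an algebraically closed field
    with its partial order. *)
Lemma ge0_perturb a b : a \is Num.real -> 0 <= b ->
  (forall t, 0 < t -> 0 <= a + t ^+ 2 * b) -> 0 <= a.
Proof.
move=> aR b0 h; have [//|a0] := real_ge0P aR.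
suff /le_lt_trans/(_ a0) : 0 <= a by rewrite ltxx.
have [b_eq|bn] := eqVneq b 0; first by have := h 1 ltr01; rewrite b_eq mulr0 addr0.
have bp : b > 0 by rewrite lt_def bn.
have tp : 0 < - a / (2 * b) by rewrite divr_gt0 ?oppr_gt0 ?mulr_gt0 ?ltr0n.
have := h (sqrtC (- a / (2 * b))); rewrite sqrtC_gt0 tp => /(_ isT).
have -> : a + sqrtC (- a / (2 * b)) ^+ 2 * b = a / 2 by rewrite sqrtCK; field.
by rewrite pmulr_lge0 ?invr_gt0 ?ltr0n.
Qed.

(** The rank-one operators below E determine E, by [below_at_eq]; those spanned by
    vectors orthogonal to e can be left out, since every x is a limit of vectors
    x + t e with E (x + t e) not orthogonal to e. *)
Lemma effect_le_off_hyperplane E F e : effects E -> effects F ->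
  hdot (E e) e != 0 ->
  (forall v, hdot v v <= 1 -> hdot v e != 0 ->
     op_le (rank_one v) E -> op_le (rank_one v) F) ->
  op_le E F.
Proof.
move=> eE eF ee h; move/effectP: (eE) => [lE aE hE].
move/effectP: (eF) => [lF aF hF].
have pE z : 0 <= hdot (E z) z by case/andP: (hE z).
have off x : hdot (E x) e != 0 -> hdot (E x) x <= hdot (F x) x.
  move=> xe; have x0 : hdot (E x) x != 0.
    by apply: contra_neq xe => /(form_null lE aE pE) ->; rewrite hdot0l.
  have v1 := hdot_below_at eE x0; have ev := effects_rank_one v1.
  have /(effect_leP ev eF)/(_ x) : op_le (rank_one (below_at E x)) F.
    apply: h => //; last by apply/effect_leP => // y; exact: below_at_le.
    by rewrite hdotZl mulf_neq0// invr_eq0 sqrtC_eq0.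
  by rewrite below_at_eq.
apply/effect_leP => // x; rewrite -subr_ge0.
have [xe|/off] := eqVneq (hdot (E x) e) 0; last by rewrite subr_ge0.
(* the terms linear in t cancel between x + t e and x - t e *)
pose d z := hdot (F z) z - hdot (E z) z.
have dR z : d z \is Num.real.
  rewrite rpredB// ger0_real ?pE//; by case/andP: (hF z).
apply: (@ge0_perturb _ (d e)) => [||t tp]; first exact: dR.
  by rewrite subr_ge0 off.
have t0 : t != 0 by rewrite gt_eqF.
have tR : t^* = t by rewrite conj_Creal// gtr0_real.
have xt s : s != 0 -> hdot (E (x + s *: e)) e != 0.
  move=> s0; rewrite (linear_D _ _ lE) (linear_Z _ _ lE) hdotDl hdotZl xe add0r.
  by rewrite mulf_neq0.
have d2 : d (x + t *: e) + d (x + (- t) *: e) = (d x + t ^+ 2 * d e) *+ 2.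
  rewrite /d !(formD _ _ lE aE) !(formD _ _ lF aF) !formZ//.
  rewrite !hdotZr !normrN (gtr0_norm tp) rmorphN /= tR.
  rewrite !rmorphM !rmorphN /= tR; ring.
rewrite -(@pmulrn_lge0 _ _ 2)// -d2.
by apply: addr_ge0; rewrite subr_ge0 off// xt// oppr_eq0.
Qed.

Lemma effect_eq_off_hyperplane E F e : effects E -> effects F ->
  hdot (E e) e != 0 ->
  (forall v, hdot v v <= 1 -> hdot v e != 0 ->
     op_le (rank_one v) E <-> op_le (rank_one v) F) ->
  E = F.
Proof.
move=> eE eF ee h.
have EF : op_le E F by apply: (effect_le_off_hyperplane eE eF ee) => v v1 ve /h; apply.
apply: op_le_anti => //; apply: (effect_le_off_hyperplane (e := e)) => //; last first.
  by move=> v v1 ve; rewrite h.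
move/(effect_leP eE eF)/(_ e): EF => Fe.
move/effectP: eE => [_ _ /(_ e) /andP[E0 _]].
by rewrite gt_eqF// (lt_le_trans _ Fe)// lt_def ee E0.
Qed.

End Determination.

(** * Maps preserving the inner product, possibly up to conjugation *)

Section InnerProductPreserving.
Context {C : numClosedFieldType} {H : hilbertType C}.
Implicit Types (x y z u v w e : H) (a b c t : C) (U V : H -> H).

Lemma hdot_inj x y : hdot x x - hdot x y - (hdot y x - hdot y y) = 0 -> x = y.
Proof.
move=> h; apply/eqP; rewrite -subr_eq0 -hdot_eq0 hdotBl !hdotBr.
by apply/eqP.
Qed.

(** Equality in Cauchy-Schwarz, for vectors of equal norm. *)
Lemma cauchy_schwarz_eq x y : hdot x x = hdot y y -> `|hdot x y| = hdot x x ->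
  exists2 c, `|c| = 1 & x = c *: y.
Proof.
move=> xy g; have [y0|y0] := eqVneq (hdot y y) 0.
  exists 1; first exact: normr1.
  by move/eqP: (y0); rewrite -xy hdot_eq0 scale1r; move/eqP: y0;
    rewrite hdot_eq0 => /eqP-> /eqP.
exists (hdot x y / hdot y y).
  by rewrite normrM normfV g xy (ger0_norm (hdot_ge0 y)) divff.
apply: hdot_inj; rewrite hdotZl !hdotZr rmorphM fmorphV /= !hdotC xy.
rewrite hdotZl.
have gg : hdot x y * hdot y x = hdot y y ^+ 2.
  by rewrite -[hdot y x]hdotC -normCK g xy.
have -> : hdot y y - hdot y x / hdot y y * hdot x y -
   (hdot x y / hdot y y * hdot y x -
    hdot y x / hdot y y * (hdot x y / hdot y y * hdot y y))
  = hdot y y - (hdot x y * hdot y x) / hdot y y by field.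
by rewrite gg expr2 mulfK// subrr.
Qed.

(** Linearity holds because the squared norm of the defect expands into inner
    products, which U preserves. *)
Lemma isometry_linear U a x y : (forall x y, hdot (U x) (U y) = hdot x y) ->
  U (a *: x + y) = a *: U x + U y.
Proof.
move=> hU; apply: hdot_inj.
rewrite !(hdotDl, hdotDr, hdotZl, hdotZr) !hU !(hdotDl, hdotDr, hdotZl, hdotZr).
by ring.
Qed.

Lemma conj_isometry_linear U a x y : (forall x y, hdot (U x) (U y) = hdot y x) ->
  U (a *: x + y) = a^* *: U x + U y.
Proof.
move=> hU; apply: hdot_inj.
rewrite !(hdotDl, hdotDr, hdotZl, hdotZr) !hU !(hdotDl, hdotDr, hdotZl, hdotZr).
by rewrite !conjCK; ring.
Qed.

Lemma isometry_inj U : (forall x y, hdot (U x) (U y) = hdot x y) -> injective U.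
Proof.
move=> hU x y Uxy; apply: hdot_inj.
by rewrite -(hU x x) -(hU x y) -(hU y x) -(hU y y) Uxy !subrr.
Qed.

Lemma conj_isometry_inj U : (forall x y, hdot (U x) (U y) = hdot y x) ->
  injective U.
Proof.
move=> hU x y Uxy; apply: hdot_inj.
by rewrite -(hU x x) -(hU x y) -(hU y x) -(hU y y) Uxy !subrr.
Qed.

Lemma onto_isometry_unitary U : (forall x y, hdot (U x) (U y) = hdot x y) ->
  (forall y, exists x, U x = y) -> exists V, unitary_with_adjoint U V.
Proof.
move=> hU /choice[V UV]; exists V.
have VU x : V (U x) = x by apply: (isometry_inj hU); rewrite UV.
split=> //; last by move=> x y; rewrite -(hU x) UV.
split; first by move=> a x y; exact: isometry_linear.
exists 1 => x; rewrite mul1r -(@ler_pXn2r _ 2)// ?nnegrE//.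
by rewrite -!hdot_norm hU.
Qed.

Lemma onto_conj_isometry_antiunitary U :
  (forall x y, hdot (U x) (U y) = hdot y x) ->
  (forall y, exists x, U x = y) -> exists V, antiunitary_with_adjoint U V.
Proof.
move=> hU /choice[V UV]; exists V.
have VU x : V (U x) = x by apply: (conj_isometry_inj hU); rewrite UV.
split=> //; first by move=> a x y; exact: conj_isometry_linear.
by move=> x; apply/eqP; rewrite -(@eqrXn2 _ 2)// -!hdot_norm hU.
Qed.

End InnerProductPreserving.

Section RealIsometry.
Context {C : numClosedFieldType} {H : hilbertType C}.
Implicit Types (x y z u v w e : H) (a b c t : C).

Context (e : H) (T : H -> H).
Context (T_shift : forall z w, hdot z e = 0 -> hdot w e = 0 ->
  `|1 + hdot (T z) (T w)| = `|1 + hdot z w|).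

Let perp z := hdot z e = 0.

Let perpD z w : perp z -> perp w -> perp (z + w).
Proof. by rewrite /perp hdotDl => -> ->; rewrite addr0. Qed.

Let perpZ a z : perp z -> perp (a *: z).
Proof. by rewrite /perp hdotZl => ->; rewrite mulr0. Qed.

Let T_norm z : perp z -> hdot (T z) (T z) = hdot z z.
Proof.
move=> pz; have := T_shift pz pz.
by rewrite !ger0_norm ?addr_ge0 ?hdot_ge0 ?ler01// => /addrI.
Qed.

(** This is the square of [T_shift]: with g = <z, w>, it reads as the invariance of
    2 Re g + |g|^2. *)
Let T_shift2 z w : perp z -> perp w ->
  hdot (T z) (T w) + hdot (T w) (T z) + `|hdot (T z) (T w)| ^+ 2 =
  hdot z w + hdot w z + `|hdot z w| ^+ 2.
Proof.
move=> pz pw; have /(congr1 (fun t : C => t ^+ 2)) := T_shift pz pw.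
rewrite !normCK !rmorphD !rmorph1 /= !hdotC => h.
by apply: (addrI 1); apply: etrans (etrans h _); ring.
Qed.

(** Against T z, Cauchy-Schwarz must be an equality for T (2 z), which is therefore a
    multiple of T z. *)
Let T_double z : perp z -> T (2 *: z) = 2 *: T z.
Proof.
move=> pz; have p2 := perpZ 2 pz; have := T_shift2 p2 pz.
set g := hdot (T _) _; set g' := hdot (T z) _.
have c2 : (2 : C)^* = 2 by rewrite conjC_nat.
rewrite hdotZl hdotZr c2 normrM exprMn (ger0_norm (hdot_ge0 z)).
rewrite (ger0_norm (ler0n C 2)) => gE.
have : `|g| ^+ 2 <= 2 ^+ 2 * hdot z z ^+ 2.
  rewrite (le_trans (cauchy_schwarz _ _))// !T_norm// hdotZl hdotZr c2.
  by rewrite le_eqVlt; apply/orP; left; apply/eqP; ring.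
rewrite -subr_ge0 => cs.
have dge := hdot_ge0 (T (2 *: z) - 2 *: T z).
apply/eqP; rewrite -subr_eq0 -hdot_eq0 eq_le dge andbT.
rewrite hdotBl !hdotBr !hdotZl !hdotZr !T_norm// hdotZl hdotZr c2 -/g -/g'.
rewrite -oppr_ge0.
have -> : - (2 * (2 * hdot z z) - 2 * g - (2 * g' - 2 * (2 * hdot z z))) =
  2 * (g + g' + `|g| ^+ 2 - 2 * hdot z z - 2 * hdot z z - 2 ^+ 2 * hdot z z ^+ 2)
  + 2 * (2 ^+ 2 * hdot z z ^+ 2 - `|g| ^+ 2) by ring.
rewrite gE; set r := 2 * (_ - _ - _ - _).
have -> : r = 0 by rewrite /r; ring.
by rewrite add0r mulr_ge0// ler0n.
Qed.

Let T_dot z w : perp z -> perp w ->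
  hdot (T z) (T w) + hdot (T w) (T z) = hdot z w + hdot w z /\
  `|hdot (T z) (T w)| ^+ 2 = `|hdot z w| ^+ 2.
Proof.
move=> pz pw; have h1 := T_shift2 pz pw; have := T_shift2 (perpZ 2 pz) pw.
rewrite T_double// !hdotZl !hdotZr conjC_nat !normrM !exprMn.
rewrite (ger0_norm (ler0n C 2)) => h2.
have m : `|hdot (T z) (T w)| ^+ 2 = `|hdot z w| ^+ 2.
  have n2 : (2 : C) != 0 by rewrite pnatr_eq0.
  apply: (mulfI n2); set m := `|_| ^+ 2.
  transitivity (2 * hdot (T z) (T w) + 2 * hdot (T w) (T z) + 2 ^+ 2 * m
    - 2 * (hdot (T z) (T w) + hdot (T w) (T z) + m)); first by ring.
  by rewrite h2 h1; ring.
split=> //; apply: (addIr (`|hdot z w| ^+ 2)); by rewrite -h1 m.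
Qed.

Let T_add z w : perp z -> perp w -> T (z + w) = T z + T w.
Proof.
move=> pz pw; have pzw := perpD pz pw; apply: hdot_inj.
have [h1 _] := T_dot pzw pz; have [h2 _] := T_dot pzw pw.
have [h3 _] := T_dot pz pw.
rewrite T_norm// !hdotDl !hdotDr !T_norm//.
move: h1 h2 h3; rewrite !hdotDl !hdotDr.
set a1 := hdot (T (z + w)) (T z); set a2 := hdot (T z) (T (z + w)).
set b1 := hdot (T (z + w)) (T w); set b2 := hdot (T w) (T (z + w)).
set c1 := hdot (T z) (T w); set c2 := hdot (T w) (T z).
move=> h1 h2 h3.
transitivity (hdot z z + hdot w z + (hdot z w + hdot w w)
  - (a1 + a2) - (b1 + b2) + (hdot z z + hdot w w + (c1 + c2))); first by ring.
by rewrite h1 h2 h3; ring.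
Qed.

Let T_i z : perp z -> T ('i *: z) = 'i *: T z \/ T ('i *: z) = - 'i *: T z.
Proof.
move=> pz; have pi := perpZ 'i pz; have [] := T_dot pi pz.
have n1 : hdot (T ('i *: z)) (T ('i *: z)) = hdot z z.
  by rewrite T_norm// hdotZl hdotZr mulrA conjCi mulrN mulCii opprK mul1r.
have n2 := T_norm pz.
have gC : (hdot (T ('i *: z)) (T z))^* = hdot (T z) (T ('i *: z)) by rewrite hdotC.
rewrite normCK gC normCK hdotC !hdotZl !hdotZr conjCi.
set g := hdot (T ('i *: z)) (T z) in gC *; set g' := hdot (T z) _ in gC *.
have ii : 'i * 'i = -1 :> C := mulCii C.
move=> h1 h2; have g'E : g' = - g.
  by apply/eqP; rewrite -addr_eq0 addrC h1; apply/eqP; ring.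
have : (g - 'i * hdot z z) * (g + 'i * hdot z z) = 0.
  have -> : (g - 'i * hdot z z) * (g + 'i * hdot z z)
          = - (g * - g) - ('i * hdot z z) * ('i * hdot z z) by ring.
  rewrite -g'E h2; ring.
move/eqP; rewrite mulf_eq0 => /orP[]; rewrite ?subr_eq0 ?addr_eq0 => /eqP gE;
  [left|right]; apply: hdot_inj.
- rewrite !hdotZl !hdotZr n1 n2 -/g -/g' conjCi g'E gE.
  have -> : hdot z z - - 'i * ('i * hdot z z)
    - ('i * - ('i * hdot z z) - 'i * (- 'i * hdot z z))
    = hdot z z + hdot z z * ('i * 'i) by ring.
  by rewrite ii; ring.
- rewrite !hdotZl !hdotZr n1 n2 -/g -/g' rmorphN /= conjCi g'E gE.
  have -> : hdot z z - - - 'i * - ('i * hdot z z)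
    - (- 'i * - - ('i * hdot z z) - - 'i * (- - 'i * hdot z z))
    = hdot z z + hdot z z * ('i * 'i) by ring.
  by rewrite ii; ring.
Qed.

(** The two solution sets are closed under sums and cover e^perp; a group is not
    the union of two proper subgroups. *)
Let T_i_uniform :
  (forall z, perp z -> T ('i *: z) = 'i *: T z) \/
  (forall z, perp z -> T ('i *: z) = - 'i *: T z).
Proof.
apply: contrapT => /not_orP[/existsNP[z /not_implyP[pz zi]]].
move=> /existsNP[w /not_implyP[pw wi]].
have [//|zE] := T_i pz; have [wE|//] := T_i pw.
have := T_i (perpD pz pw); rewrite scalerDr !T_add//; try exact: perpZ.
rewrite zE wE !scalerDr => -[/addIr zz|/addrI ww]; first by apply: zi; rewrite zE.
by apply: wi; rewrite wE.
Qed.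

(** A map of e^perp that preserves |1 + <z, w>| preserves the real part and the
    modulus of the inner product separately: squaring shows that 2 Re g + |g|^2 is
    preserved for g = <z, w>, and doubling z weights the two terms differently.
    It is therefore additive, and maps i z to i T z or to - i T z, with the same sign
    for all z. *)
Lemma shift_isometry :
  (forall z w, hdot z e = 0 -> hdot w e = 0 -> hdot (T z) (T w) = hdot z w) \/
  (forall z w, hdot z e = 0 -> hdot w e = 0 -> hdot (T z) (T w) = hdot w z).
Proof.
have n2 : (2 : C) != 0 by rewrite pnatr_eq0.
have ni : ('i : C) != 0 := neq0Ci C.
have ii : 'i * 'i = -1 :> C := mulCii C.
case: T_i_uniform => hi; [left|right] => z w pz pw;
  have [h1 _] := T_dot pz pw; have [h2 _] := T_dot (perpZ 'i pz) pw;
  move: h2; rewrite hi// !hdotZl !hdotZr ?rmorphN /= conjCi => h2;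
  apply: (mulfI n2); apply: (mulfI ni).
- have -> : 'i * (2 * hdot (T z) (T w)) =
     'i * (hdot (T z) (T w) + hdot (T w) (T z))
     + ('i * hdot (T z) (T w) + - 'i * hdot (T w) (T z)) by ring.
  by rewrite h1 h2; ring.
- have -> : 'i * (2 * hdot (T z) (T w)) =
     'i * (hdot (T z) (T w) + hdot (T w) (T z))
     - (- 'i * hdot (T z) (T w) + - - 'i * hdot (T w) (T z)) by ring.
  by rewrite h1 h2; ring.
Qed.

End RealIsometry.

(** * Wigner's theorem off a hyperplane *)

Section Wigner.
Context {C : numClosedFieldType} {H : hilbertType C}.
Implicit Types (x y z u v w e : H) (a b c t : C) (U V : H -> H).

(** On the affine hyperplane e + e^perp the map p can be normalized so that the
    image has component p e along p e. What remains is a map T of e^perp to which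
    [shift_isometry] applies, and x -> <x, e> p e + T (proj x), with <x, e>
    conjugated in the second case, is the required U. Asking for nothing on e^perp
    is what makes the lemma applicable when the state has a kernel. *)
Lemma wigner_off_hyperplane (e : H) (p : H -> H) : hdot e e = 1 ->
  (forall x y, hdot x e != 0 -> hdot y e != 0 ->
     `|hdot (p x) (p y)| = `|hdot x y|) ->
  (forall y, hdot y (p e) != 0 -> exists2 x, hdot x e != 0 &
     exists a, y = a *: p x) ->
  exists U, [/\ (forall x y, hdot (U x) (U y) = hdot x y) \/
                (forall x y, hdot (U x) (U y) = hdot y x),
    (forall y, exists x, U x = y) &
    forall x, hdot x e != 0 -> exists2 c, `|c| = 1 & U x = c *: p x].
Proof.
move=> e1 hp onto; set e' := p e.
have e_off : hdot e e != 0 by rewrite e1 oner_eq0.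
have p_norm x : hdot x e != 0 -> hdot (p x) (p x) = hdot x x.
  by move=> x0; have := hp x x x0 x0; rewrite !ger0_norm ?hdot_ge0.
have e'1 : hdot e' e' = 1 by rewrite p_norm.
have shift1 z : hdot z e = 0 -> hdot (e + z) e = 1.
  by move=> ze; rewrite hdotDl ze addr0.
have shift_off z : hdot z e = 0 -> hdot (e + z) e != 0.
  by move=> /shift1 ->; rewrite oner_eq0.
have phase z : hdot z e = 0 -> `|hdot (p (e + z)) e'| = 1.
  by move=> ze; rewrite hp ?shift_off// shift1// normr1.
(* the multiple of p (e + z) whose component along e' is e' itself *)
pose q z := (hdot (p (e + z)) e')^* *: p (e + z).
have qe z : hdot z e = 0 -> hdot (q z) e' = 1.
  by move=> ze; rewrite hdotZl mulrC -normCK phase// expr1n.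
have qe2 z : hdot z e = 0 -> hdot e' (q z) = 1.
  by move=> ze; rewrite -hdotC qe// rmorph1.
have q0 : q 0 = e' by rewrite /q addr0 e'1 rmorph1 scale1r.
pose T z := q z - e'.
have Te z : hdot z e = 0 -> hdot (T z) e' = 0.
  by move=> ze; rewrite hdotBl qe// e'1 subrr.
have Te2 z : hdot z e = 0 -> hdot e' (T z) = 0.
  by move=> ze; rewrite hdotBr qe2// e'1 subrr.
have T_shift z w : hdot z e = 0 -> hdot w e = 0 ->
    `|1 + hdot (T z) (T w)| = `|1 + hdot z w|.
  move=> ze we; rewrite [hdot (T z) _]hdotBr Te// subr0 hdotBl qe2// addrC subrK.
  rewrite hdotZl hdotZr !normrM !norm_conjC !phase// !mul1r hp ?shift_off//.
  rewrite hdotDl !hdotDr e1 ze -[hdot e w]hdotC we conjC0 addr0 add0r.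
  by [].
have Tq z : e' + T z = q z by rewrite addrC subrK.
clearbody T; pose proj x := x - hdot x e *: e.
have proj_perp x : hdot (proj x) e = 0 by rewrite hdotBl hdotZl e1 mulr1 subrr.
have proj_dot x y : hdot (proj x) (proj y) = hdot x y - hdot x e * hdot e y.
  by rewrite [LHS]hdotBr hdotZr proj_perp mulr0 subr0 hdotBl hdotZl.
have projS z : hdot z e = 0 -> proj (e + z) = z.
  by move=> ze; rewrite /proj shift1// scale1r addrC addKr.
(* x is <x, e> times a vector of e + e^perp, and p respects rays by the case of
   equality in Cauchy-Schwarz *)
have along x a : hdot x e != 0 -> `|a| = `|hdot x e| ->
    exists2 c, `|c| = 1 & a *: q ((hdot x e)^-1 *: x - e) = c *: p x.
  move=> x0; set b := hdot x e => ab.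
  have ze : hdot (b^-1 *: x - e) e = 0 by rewrite hdotBl hdotZl mulVf// e1 subrr.
  have ez : e + (b^-1 *: x - e) = b^-1 *: x by rewrite addrC subrK.
  have bx : hdot (b^-1 *: x) e != 0 by rewrite hdotZl mulVf// oner_eq0.
  have b0 : `|b| != 0 by rewrite normr_eq0.
  have ph : `|hdot (p (b^-1 *: x)) e'| = 1 by rewrite -ez phase.
  have n1 : hdot (a *: q (b^-1 *: x - e)) (a *: q (b^-1 *: x - e)) = hdot x x.
    rewrite hdotZZ /q ez hdotZZ norm_conjC ph expr1n mul1r p_norm// hdotZZ ab.
    by rewrite normfV exprVn mulrA divff ?mul1r// expf_neq0.
  apply: (cauchy_schwarz_eq (etrans n1 (esym (p_norm _ x0)))).
  apply: etrans _ (esym n1); rewrite /q ez !hdotZl !normrM norm_conjC.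
  rewrite ph mul1r hp// hdotZl normrM normfV ab mulrA divff// mul1r.
  by rewrite ger0_norm// hdot_ge0.
(* s is the identity or the conjugation: both cases end in the same way *)
have finish (s : C -> C) U : (forall a, `|s a| = `|a|) -> involutive s ->
    s (-1) = -1 -> (forall a x y, U (a *: x + y) = s a *: U x + U y) ->
    (forall z, hdot z e = 0 -> U (e + z) = q z) ->
    (forall y, exists x, U x = y) /\
    forall x, hdot x e != 0 -> exists2 c, `|c| = 1 & U x = c *: p x.
  move=> s_norm s_inv sN1 Us Uq.
  have U0 : U 0 = 0 by have := Us (-1) 0 0; rewrite sN1 !scaleN1r !addNr.
  have UZ a x : U (a *: x) = s a *: U x by rewrite -[a *: x]addr0 Us U0 addr0.
  have UB x y : U (x - y) = U x - U y by rewrite addrC -scaleN1r Us sN1 scaleN1r addrC.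
  have Up x : hdot x e != 0 -> exists2 c, `|c| = 1 & U x = c *: p x.
    move=> x0; have [c c1 cx] := along _ _ x0 (s_norm (hdot x e)).
    exists c => //; rewrite -cx -Uq; last by rewrite hdotBl hdotZl mulVf// e1 subrr.
    by rewrite addrC subrK -UZ scalerA divff// scale1r.
  split=> //; have off y : hdot y e' != 0 -> exists x, U x = y.
    move=> /onto[x x0 [a ->]]; have [c c1 cx] := Up _ x0.
    have c0 : c != 0 by rewrite -normr_eq0 c1 oner_eq0.
    by exists (s (a / c) *: x); rewrite UZ s_inv cx scalerA divfK.
  move=> y; have [ye|/off//] := eqVneq (hdot y e') 0.
  have [x xy] : exists x, U x = y + e'.
    by apply: off; rewrite hdotDl ye e'1 add0r oner_eq0.
  exists (x - e); rewrite UB xy -[e]addr0 Uq ?hdot0l// q0.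
  by rewrite addrK.
have [hT|hT] := shift_isometry T_shift.
- pose U x := hdot x e *: e' + T (proj x).
  have hU x y : hdot (U x) (U y) = hdot x y.
    rewrite hdotDl !hdotDr !hdotZl !hdotZr e'1 Te// Te2// hT// proj_dot hdotC.
    by ring.
  have [||||z ze|Uonto Up] := finish id U; rewrite //.
  + by move=> a x y; exact: isometry_linear.
  + by rewrite /U shift1// projS// scale1r.
  by exists U; split=> //; left.
- pose U x := (hdot x e)^* *: e' + T (proj x).
  have hU x y : hdot (U x) (U y) = hdot y x.
    rewrite hdotDl !hdotDr !hdotZl !hdotZr e'1 Te// Te2// hT// proj_dot conjCK !hdotC.
    by ring.
  have [||||z ze|Uonto Up] := finish Num.conj U; rewrite //.
  + exact: norm_conjC.
  + exact: conjCK.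
  + by rewrite rmorphN1.
  + by move=> a x y; exact: conj_isometry_linear.
  + by rewrite /U shift1// projS// rmorph1 scale1r.
  by exists U; split=> //; right.
Qed.

End Wigner.

(** * Orthonormal bases and Parseval *)

Section OrthonormalBases.
Context {C : numClosedFieldType} {H : hilbertType C}.
Implicit Types (x y z u v w e : H) (a b c t : C).

(** A maximal orthonormal set leaves no nonzero vector orthogonal to it. *)
Lemma exists_orthonormal_basis : exists B : set H, orthonormal_basis B.
Proof.
pose ortho (B : set H) := forall x y, B x -> B y -> hdot x y = (x == y)%:R.
have [F Fo tot|B [oB maxB]] := @Zorn_bigcup H ortho.
  move=> x y [X FX Xx] [Y FY Yy].
  by have [XY|YX] := tot _ _ FX FY; [apply: (Fo Y)|apply: (Fo X)] => //;
    [exact: XY|exact: YX].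
exists B; split=> // x xB; apply/eqP; apply: contrapT => /negP x0.
have n0 : `|x| != 0 by rewrite normr_eq0.
pose f := `|x|^-1 *: x.
have f1 : hdot f f = 1.
  by rewrite hdotZZ hdot_norm normfV normr_id exprVn mulVf// expf_neq0.
have fB e : B e -> hdot f e = 0 by move=> Be; rewrite hdotZl xB// mulr0.
have fB2 e : B e -> hdot e f = 0 by move=> Be; rewrite -hdotC fB// conjC0.
apply: (maxB (B `|` [set f])).
  split; first by move=> z; left.
  move=> /(_ f (or_intror erefl)) Bf.
  by have := fB _ Bf; rewrite f1 => /eqP; rewrite oner_eq0.
have neq e : B e -> (e == f) = false.
  by move=> Be; apply/eqP => ef; have := fB _ Be; rewrite ef f1 => /eqP;
    rewrite oner_eq0.
move=> y z [By|->] [Bz|->]; first exact: oB.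
- by rewrite fB2// neq.
- by rewrite fB// eq_sym neq.
- by rewrite f1 eqxx.
Qed.

Lemma cvg_hdotl (I : Type) (F : set_system I) (f : I -> H) (l y : H) :
  Filter F -> f @ F --> l -> (fun i => hdot (f i) y) @ F --> hdot l y.
Proof.
move=> FF /cvgrPdist_lt fl; apply/cvgrPdist_lt => eps eps0.
have y1 : 0 < `|y| + 1 by rewrite ltr_wpDl.
have := fl (eps / (`|y| + 1)) (divr_gt0 eps0 y1).
apply: filterS => i; rewrite ltr_pdivlMr// -hdotBl; apply: le_lt_trans.
rewrite -(@ler_pXn2r _ 2)// ?nnegrE ?mulr_ge0// ?(ltW y1)//.
rewrite (le_trans (cauchy_schwarz _ _))// !hdot_norm exprMn ler_wpM2l ?exprn_ge0//.
by rewrite ler_pXn2r ?nnegrE ?(ltW y1)// lerDl.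
Qed.

Lemma hdot_suml (I : Type) (r : seq I) (P : pred I) (F : I -> H) y :
  hdot (\sum_(i <- r | P i) F i) y = \sum_(i <- r | P i) hdot (F i) y.
Proof. by apply: (big_morph (hdot^~ y)) => [u v|]; rewrite ?hdotDl ?hdot0l. Qed.

Lemma hdot_sumr (I : Type) (r : seq I) (P : pred I) (F : I -> H) y :
  hdot y (\sum_(i <- r | P i) F i) = \sum_(i <- r | P i) hdot y (F i).
Proof. by apply: (big_morph (hdot y)) => [u v|]; rewrite ?hdotDr ?hdot0r. Qed.

Lemma partial_sumE (B : set H) (V : zmodType) (f : set_type B -> V) (A : {fset (set_type B)}) :
  partial_sum f A = \sum_(i <- A) f i.
Proof. by rewrite big_seq_fsetE. Qed.

End OrthonormalBases.

Lemma totally_cvg_unique (C : numFieldType) (I : choiceType)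
  (f : {fset I} -> C^o) (a b : C) : f @ totally --> a -> f @ totally --> b -> a = b.
Proof.
move=> fa fb; have FF : ProperFilter (@totally I) := totally_filter.
exact: (@cvg_unique _ (@norm_hausdorff C C^o) _ (fmap_proper_filter f FF) a b).
Qed.

Section FourierSums.
Context {C : numClosedFieldType} {H : hilbertType C}.
Context (B : set H) (oB : orthonormal_basis B) (x : H).
Implicit Types (A : {fset (set_type B)}).

Let S A : H := partial_sum (fun i : set_type B => hdot x (val i) *: val i) A.
Let s A : C := partial_sum (fun i : set_type B => `|hdot x (val i)| ^+ 2) A.

Let dotB (i j : set_type B) : hdot (val i) (val j) = (i == j)%:R.
Proof. by case: oB => o _; rewrite o ?val_eqE//; exact/set_mem/valP. Qed.

Lemma hdot_fourier A (j : set_type B) : j \in A ->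
  hdot (S A) (val j) = hdot x (val j).
Proof.
move=> jA; rewrite /S partial_sumE hdot_suml (big_fsetD1 j)//= hdotZl dotB eqxx mulr1.
rewrite big_seq big1 ?addr0// => i; rewrite !inE => /andP[ij _].
by rewrite hdotZl dotB (negbTE ij) mulr0.
Qed.

Lemma hdot_fourierS A A' : (A `<=` A')%fset -> hdot (S A') (S A) = s A.
Proof.
move=> AA'; rewrite {2}/S /s !partial_sumE hdot_sumr big_seq [RHS]big_seq.
apply: eq_bigr => i iA; rewrite hdotZr hdot_fourier ?(fsubsetP AA')//.
by rewrite mulrC normCK.
Qed.

Lemma fourier_sub A A' : (A `<=` A')%fset ->
  hdot (S A' - S A) (S A' - S A) = s A' - s A.
Proof.
move=> AA'; have sR : (s A)^* = s A.
  apply: conj_Creal; rewrite /s partial_sumE rpred_sum// => i _.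
  by rewrite rpredX// normr_real.
rewrite hdotBl !hdotBr (hdot_fourierS AA') !(hdot_fourierS (fsubset_refl _)).
by rewrite -[hdot (S A) (S A')]hdotC (hdot_fourierS AA') sR subrr subr0.
Qed.

Lemma bessel A : s A <= hdot x x.
Proof.
have xS : hdot x (S A) = s A.
  rewrite /S /s !partial_sumE hdot_sumr; apply: eq_bigr => i _.
  by rewrite hdotZr mulrC normCK.
have sR : (s A)^* = s A.
  apply: conj_Creal; rewrite /s partial_sumE rpred_sum// => i _.
  by rewrite rpredX// normr_real.
have := hdot_ge0 (x - S A); rewrite hdotBl !hdotBr hdot_fourierS ?fsubset_refl//.
by rewrite -[hdot (S A) x]hdotC xS sR subrr subr0 subr_ge0.
Qed.

End FourierSums.

Section Parseval.
Context {R : realType} {H : hilbertType (complexes R)}.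
Context (B : set H) (oB : orthonormal_basis B).
Local Notation C := (complexes R).

(** By Bessel the sums of |<x, e>|^2 over finite subsets are bounded, so a finite
    subset nearly reaching their supremum controls all larger ones: the Fourier
    sums are a Cauchy net, and the difference of x and its limit is orthogonal to
    the basis. *)
Lemma cvg_fourier (x : H) :
  partial_sum (fun i : set_type B => hdot x (val i) *: val i) @ totally --> x.
Proof.
set S := partial_sum _.
pose s (A : {fset (set_type B)}) : C :=
  partial_sum (fun i : set_type B => `|hdot x (val i)| ^+ 2) A.
have sR A : s A \is Num.real.
  by rewrite /s partial_sumE rpred_sum// => i _; rewrite rpredX// normr_real.
(* the supremum lives in R, the partial sums are real elements of C *)
pose X : set R := [set complex.Re (s A) | A in setT].
have supX : has_sup X.
  split; first by exists (complex.Re (s fset0)), fset0.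
  exists (complex.Re (hdot x x)) => _ [A _ <-].
  by have := bessel oB x A; rewrite lecE => /andP[].
have FF : ProperFilter (@totally (set_type B)) := totally_filter.
have cS : cauchy (S @ totally).
  apply: cauchy_exP => eps eps0.
  have e2 : 0 < complex.Re (eps ^+ 2).
    by have := exprn_gt0 2 eps0; rewrite ltcE => /andP[].
  have [_ [A0 _ <-] hA0] := sup_adherent e2 supX.
  exists (S A0); exists A0 => // A /= A0A; rewrite -ball_normE /=.
  rewrite distrC -(@ltr_pXn2r _ 2)// ?nnegrE ?(ltW eps0)//.
  rewrite -hdot_norm fourier_sub// ltcE.
  have im0 (z : C) : z \is Num.real -> complex.Im z = 0.
    by move=> /(@complex_realP R)[k ->].
  have r1 : s A - s A0 \is Num.real by exact: rpredB.
  have r2 : eps ^+ 2 \is Num.real by rewrite rpredX// gtr0_real.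
  rewrite (im0 _ r1) (im0 _ r2) eqxx /=.
  have : complex.Re (s A) <= sup X by apply: sup_upper_bound => //; exists A.
  have -> : complex.Re (s A - s A0) = complex.Re (s A) - complex.Re (s A0).
    by rewrite raddfB.
  rewrite ltrBlDr => /le_lt_trans; apply; by rewrite -ltrBlDl.
have [l Sl] := (cvg_ex _).1 (cauchy_cvg _ cS).
suff -> : x = l by [].
apply/eqP; rewrite -subr_eq0; apply/eqP; case: (oB) => _; apply => e Be.
rewrite hdotBl; apply/eqP; rewrite subr_eq0; apply/eqP.
pose j : set_type B := SigSub (mem_set Be).
apply: (@totally_cvg_unique C _ (fun A => hdot (S A) e)).
  apply: cvg_near_cst; exists [fset j]%fset => // A /= jA.
  by apply: (hdot_fourier oB x (j := j)); rewrite -fsub1set.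
exact: cvg_hdotl.
Qed.

End Parseval.

(** * Traces against rank-one operators *)

Section Traces.
Context {R : realType} {H : hilbertType (complexes R)}.
Local Notation C := (complexes R).
Implicit Types (D T : H -> H) (c : C) (v : H).

Lemma traceE T c : has_trace T c -> trace T = c.
Proof.
move=> Tc; have [B oB] := @exists_orthonormal_basis _ H.
apply: xget_unique => //= c' Tc'.
exact: (totally_cvg_unique (Tc' _ oB) (Tc _ oB)).
Qed.

(** Parseval's identity for v against D v. *)
Lemma has_trace_rank_one D v : is_adjoint D D ->
  has_trace (rank_one v \o D) (hdot (D v) v).
Proof.
move=> aD B oB; have FF : ProperFilter (@totally (set_type B)) := totally_filter.
have := cvg_hdotl (y := D v) FF (cvg_fourier oB (x := v)).
rewrite -aD; apply: cvg_trans; apply: near_eq_cvg; apply: nearW => A.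
rewrite !partial_sumE hdot_suml; apply: eq_bigr => i _.
by rewrite /= !hdotZl -aD mulrC.
Qed.

Lemma has_trace_compl_rank_one D v : is_adjoint D D -> has_trace D 1 ->
  has_trace (effect_compl (rank_one v) \o D) (1 - hdot (D v) v).
Proof.
move=> aD D1 B oB; have FF : ProperFilter (@totally (set_type B)) := totally_filter.
set f := partial_sum _.
have -> : f = (partial_sum (fun e : set_type B => hdot (D (val e)) (val e)) : _ -> C^o)
  - partial_sum (fun e : set_type B => hdot ((rank_one v \o D) (val e)) (val e)).
  apply/funext => A.
  rewrite -[RHS]/(partial_sum _ A - partial_sum _ A) /f !partial_sumE -sumrB.
  by apply: eq_bigr => i _; rewrite /= /effect_compl hdotBl.
by apply: (@cvgB C C^o); [exact: D1 | exact: has_trace_rank_one].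
Qed.

Lemma state_has_trace1 D : state D -> has_trace D 1.
Proof.
case=> _ _; rewrite /trace => D1; case: (pselect (exists c, has_trace D c)) => h.
  by have := xgetPex 0 h; rewrite D1.
have : (1 : C) != 0 by exact: oner_neq0.
rewrite -D1 xgetPN ?eqxx// => c Dc; apply: h; by exists c.
Qed.

End Traces.

(** * Order automorphisms of the effects *)

Section OrderAutomorphisms.
Context {C : numClosedFieldType} {H : hilbertType C}.
Implicit Types (x y z u v w e : H) (a b c t : C) (E F A B : H -> H).
Implicit Types (phi psi : (H -> H) -> (H -> H)).

Definition order_automorphism phi : Prop := set_bij effects effects phi /\
  forall E F, effects E -> effects F -> (op_le E F <-> op_le (phi E) (phi F)).

Lemma order_automorphism_inv phi : order_automorphism phi ->
  exists psi, order_automorphism psi /\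
    forall E, effects E -> psi (phi E) = E /\ phi (psi E) = E.
Proof.
move=> [[fphi iphi sphi] ophi].
have /choice[psi hpsi] : forall E, exists F, effects E -> effects F /\ phi F = E.
  move=> E; case: (pselect (effects E)) => [eE|nE]; last by exists E.
  by have [F eF FE] := sphi _ eE; exists F.
have psiK E : effects E -> psi (phi E) = E.
  move=> eE; have [epE pE] := hpsi _ (fphi _ eE).
  by apply: iphi => //; exact/mem_set.
exists psi; split; last by move=> E eE; split; [exact: psiK|case: (hpsi _ eE)].
split; last first.
  move=> E F eE eF; have [e1 h1] := hpsi _ eE; have [e2 h2] := hpsi _ eF.
  have := ophi _ _ e1 e2; rewrite h1 h2; exact: iff_sym.
split.
- by move=> E /hpsi[].
- move=> E F /set_mem eE /set_mem eF EF.
  by have [_ <-] := hpsi _ eE; have [_ <-] := hpsi _ eF; rewrite EF.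
- by move=> E eE; exists (phi E); [exact: fphi|exact: psiK].
Qed.

(** The complementation reverses the order, so phi can be conjugated by it; this
    turns every fact about rank-one effects into one about their complements. *)
Definition dual_map phi E := effect_compl (phi (effect_compl E)).

Lemma order_automorphism_dual phi :
  order_automorphism phi -> order_automorphism (dual_map phi).
Proof.
move=> [[fphi iphi sphi] ophi]; split.
  split.
  - by move=> E eE; exact/effects_compl/fphi/effects_compl.
  - move=> E F /set_mem eE /set_mem eF EF.
    rewrite -[E]effect_complK -[F]effect_complK; congr effect_compl.
    apply: iphi; try by apply/mem_set/effects_compl.
    by rewrite -[LHS]effect_complK -[RHS]effect_complK; congr effect_compl.
  - move=> E eE; have [F eF FE] := sphi _ (effects_compl eE).
    exists (effect_compl F); first exact: effects_compl.
    by rewrite /dual_map effect_complK FE effect_complK.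
move=> E F eE eF; rewrite op_le_compl -ophi; try exact: effects_compl.
by rewrite op_le_compl.
Qed.

Section Fixed.
Context (phi : (H -> H) -> (H -> H)) (aphi : order_automorphism phi).

Lemma order_automorphism_effects E : effects E -> effects (phi E).
Proof. by case: aphi => -[h _ _] _ /h. Qed.

(** phi preserves [chain_below]. *)
Lemma order_automorphism_rank_one v : hdot v v <= 1 ->
  exists2 w, hdot w w <= 1 & phi (rank_one v) = rank_one w.
Proof.
move=> v1; have ev := effects_rank_one v1.
apply: chain_below_rank1; first exact: order_automorphism_effects.
move=> A B eA eB; case: (aphi) => -[_ _ s] o.
have [A' eA' <-] := s _ eA; have [B' eB' <-] := s _ eB.
rewrite -!o//; exact: chain_below_rank_one.
Qed.

End Fixed.

Lemma rank_one_max x v : hdot x x = 1 -> hdot v v <= 1 ->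
  op_le (rank_one x) (rank_one v) -> rank_one v = rank_one x.
Proof.
move=> x1 v1; have ev := effects_rank_one v1.
have ex : effects (rank_one x) by apply: effects_rank_one; rewrite x1.
move=> /(effect_leP ex ev)/rank_one_leP[c c1 xE].
rewrite xE rank_one_scale//; apply/eqP; rewrite eq_le c1/=.
have : 1 <= `|c| ^+ 2.
  move: x1; rewrite xE hdotZZ => <-; by rewrite ler_piMr// exprn_ge0.
by rewrite -[1 in X in X -> _](expr1n _ 2) ler_pXn2r ?nnegrE.
Qed.

Lemma unit_above w u0 : hdot w w <= 1 -> hdot u0 u0 = 1 ->
  exists2 u, hdot u u = 1 & op_le (rank_one w) (rank_one u).
Proof.
move=> w1 u01; have ew := effects_rank_one w1.
have [w0|w0] := eqVneq w 0.
  exists u0 => //; apply/effect_leP => // [|x].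
    by apply: effects_rank_one; rewrite u01.
  by rewrite !rank_oneE w0 hdot0r normr0 expr0n exprn_ge0.
have n0 : `|w| != 0 by rewrite normr_eq0.
have u1 : hdot (`|w|^-1 *: w) (`|w|^-1 *: w) = 1.
  by rewrite hdotZZ hdot_norm normfV normr_id exprVn mulVf// expf_neq0.
exists (`|w|^-1 *: w) => //; apply/effect_leP => // [|x].
  by apply: effects_rank_one; rewrite u1.
rewrite !rank_oneE hdotZr normrM norm_conjC exprMn ler_peMl ?exprn_ge0//.
by rewrite normfV normr_id exprVn -hdot_norm invf_ge1// hdot_gt0.
Qed.

(** Rank-one projections are the maximal ones among the rank-one effects. *)
Lemma order_automorphism_unit phi x : order_automorphism phi -> hdot x x = 1 ->
  exists2 w, hdot w w = 1 & phi (rank_one x) = rank_one w.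
Proof.
move=> aphi x1; have [psi [apsi phiK]] := order_automorphism_inv aphi.
have ex : effects (rank_one x) by apply: effects_rank_one; rewrite x1.
have [w w1 wE] : exists2 w, hdot w w <= 1 & phi (rank_one x) = rank_one w.
  by apply: order_automorphism_rank_one => //; rewrite x1.
have [u u1 wu] := unit_above w1 x1.
have eu : effects (rank_one u) by apply: effects_rank_one; rewrite u1.
have [v v1 vE] : exists2 v, hdot v v <= 1 & psi (rank_one u) = rank_one v.
  by apply: order_automorphism_rank_one => //; rewrite u1.
have ev := effects_rank_one v1.
have vu : phi (rank_one v) = rank_one u by rewrite -vE; have [] := phiK _ eu.
exists u => //; rewrite -vu (@rank_one_max x v)//.
by case: (aphi) => _ o; rewrite o// wE vu.
Qed.

Lemma order_automorphism_unit_onto phi w : order_automorphism phi -> hdot w w = 1 ->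
  exists2 x, hdot x x = 1 & phi (rank_one x) = rank_one w.
Proof.
move=> aphi w1; have [psi [apsi phiK]] := order_automorphism_inv aphi.
have [x x1 xE] := order_automorphism_unit apsi w1; exists x => //.
by rewrite -xE; have [] := phiK (rank_one w) _; last by []; apply: effects_rank_one;
  rewrite w1.
Qed.

Lemma rank_one_norm a c x : `|a| = `|c| -> rank_one (a *: x) = rank_one (c *: x).
Proof.
move=> ac; apply/funext => z; rewrite /rank_one !hdotZr !scalerA mulrAC.
by rewrite [in RHS]mulrAC ![_^* * _]mulrC -!normCK ac.
Qed.

(** The order alone does not fix how phi parametrizes the multiples of a
    projection; a homogeneous weight that phi transports, and that is not zero
    there, does. *)
Lemma order_automorphism_scale phi (q q' : H -> C) x x' a :
  order_automorphism phi ->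
  (forall c v, q (c *: v) = `|c| ^+ 2 * q v) ->
  (forall c v, q' (c *: v) = `|c| ^+ 2 * q' v) ->
  (forall v w, hdot v v <= 1 -> phi (rank_one v) = rank_one w -> q v = q' w) ->
  hdot x x = 1 -> hdot x' x' = 1 -> phi (rank_one x) = rank_one x' ->
  q x != 0 -> `|a| <= 1 ->
  phi (rank_one (a *: x)) = rank_one (a *: x').
Proof.
move=> aphi qZ q'Z qq' x1 x'1 xx' qx a1.
have ax1 : hdot (a *: x) (a *: x) <= 1 by rewrite hdotZZ x1 mulr1 expr_le1.
have eax := effects_rank_one ax1.
have ex : effects (rank_one x) by apply: effects_rank_one; rewrite x1.
have ex' : effects (rank_one x') by apply: effects_rank_one; rewrite x'1.
have [w w1 wE] := order_automorphism_rank_one aphi ax1.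
have ew := effects_rank_one w1.
have : op_le (rank_one w) (rank_one x').
  case: (aphi) => _ o; rewrite -wE -xx' -o//; apply/effect_leP => // z.
  rewrite !rank_oneE hdotZr normrM norm_conjC exprMn ler_piMl ?exprn_ge0//.
  by rewrite expr_le1.
move=> /(effect_leP ew ex')/rank_one_leP[c c1 wc].
rewrite wE wc; apply: rank_one_norm; apply/eqP.
rewrite -(@eqrXn2 _ 2)//; apply/eqP; apply: (mulIf qx).
by rewrite -(qZ a) (qq' _ _ ax1 wE) wc q'Z (qq' x x') ?x1.
Qed.

(** The bound is tested at |t|^2 = 1 / a. *)
Lemma le_of_scaled_le1 (a b : C) : 0 < a -> 0 < b ->
  (forall t, `|t| <= 1 -> `|t| ^+ 2 * a <= 1 -> `|t| ^+ 2 * b <= 1) ->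
  1 <= a -> b <= a.
Proof.
move=> a0 b0 h a1; have ai : 0 <= a^-1 by rewrite invr_ge0 ltW.
have s2 : `|sqrtC a^-1| ^+ 2 = a^-1 by rewrite -normrX sqrtCK ger0_norm.
have := h (sqrtC a^-1); rewrite s2 mulVf ?gt_eqF// => /(_ _ (lexx _)).
rewrite mulrC ler_pdivrMr// mul1r; apply.
by rewrite -(@expr_le1 _ 2)// s2 invf_le1.
Qed.

(** The transition probability of x and y is read off, by [rank_one_le_compl_half],
    from the order between multiples of x and the complement of a multiple of y;
    hence one ray is moved by phi and the other one by its dual. *)
Lemma order_automorphism_transition phi (q q' : H -> C) x x' y y' :
  order_automorphism phi ->
  (forall c v, q (c *: v) = `|c| ^+ 2 * q v) ->
  (forall c v, q' (c *: v) = `|c| ^+ 2 * q' v) ->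
  (forall v w, hdot v v <= 1 -> phi (rank_one v) = rank_one w -> q v = q' w) ->
  (forall v w, hdot v v <= 1 -> dual_map phi (rank_one v) = rank_one w -> q v = q' w) ->
  hdot x x = 1 -> hdot x' x' = 1 -> phi (rank_one x) = rank_one x' -> q x != 0 ->
  hdot y y = 1 -> hdot y' y' = 1 -> dual_map phi (rank_one y) = rank_one y' -> q y != 0 ->
  `|hdot x' y'| = `|hdot x y|.
Proof.
move=> aphi qZ q'Z qq' qd x1 x'1 xx' qx y1 y'1 yy' qy.
have r1 : `|sqrtC 2^-1 : C| <= 1.
  rewrite -(@expr_le1 _ 2)// -normrX sqrtCK ger0_norm ?invr_ge0 ?ler0n//.
  by rewrite invf_le1 ?ler1n ?ltr0n.
have key t : `|t| <= 1 -> (`|t| ^+ 2 * (1 + `|hdot x y| ^+ 2) <= 1 <->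
    `|t| ^+ 2 * (1 + `|hdot x' y'| ^+ 2) <= 1).
  move=> t1; rewrite -!rank_one_le_compl_half//.
  have eff c z : `|c| <= 1 -> hdot z z = 1 -> effects (rank_one (c *: z)).
    by move=> c1 z1; apply: effects_rank_one; rewrite hdotZZ z1 mulr1 expr_le1.
  rewrite -!effect_leP; try by do ?[apply: effects_compl]; exact: eff.
  rewrite -(order_automorphism_scale aphi qZ q'Z qq' x1 x'1)//.
  rewrite -(order_automorphism_scale (order_automorphism_dual aphi) qZ q'Z qd y1 y'1)//.
  rewrite /dual_map effect_complK; case: (aphi) => _; apply; first exact: eff.
  by apply: effects_compl; exact: eff.
have p1 (c : C) : 1 <= 1 + `|c| ^+ 2 by rewrite lerDl exprn_ge0.
have p0 (c : C) : 0 < 1 + `|c| ^+ 2 by rewrite (lt_le_trans ltr01).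
apply/eqP; rewrite -(@eqrXn2 _ 2)// -(inj_eq (addrI 1)) eq_le.
by apply/andP; split; apply: le_of_scaled_le1 => // t t1; rewrite key.
Qed.

End OrderAutomorphisms.

(** * From transition probabilities to the (anti)unitary operator *)

Section Conclusion.
Context {C : numClosedFieldType} {H : hilbertType C}.
Implicit Types (x y z u v w e : H) (a b c t : C) (E F A B : H -> H).
Implicit Types (phi psi : (H -> H) -> (H -> H)).

Section Conjugation.
Context (U V : H -> H).
Context (U_dot : (forall x y, hdot (U x) (U y) = hdot x y) \/
                 (forall x y, hdot (U x) (U y) = hdot y x)).
Context (VK : cancel V U).

Lemma effects_pullback F : effects F -> effects (V \o F \o U) /\
  forall x, hdot (V (F (U x))) x = hdot (F (U x)) (U x).
Proof.
move=> /effectP[lF aF hF].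
have form x : hdot (V (F (U x))) x = hdot (F (U x)) (U x).
  by case: U_dot => U_dot'; [rewrite -U_dot' VK|rewrite -U_dot' VK -aF].
split=> //; apply/effectP; split.
- move=> a x y /=; case: U_dot => U_dot'.
    have V_dot u w : hdot (V u) (V w) = hdot u w by rewrite -U_dot' !VK.
    by rewrite isometry_linear// lF isometry_linear.
  have V_dot u w : hdot (V u) (V w) = hdot w u by rewrite -U_dot' !VK.
  by rewrite conj_isometry_linear// lF conj_isometry_linear// conjCK.
- move=> x y /=; case: U_dot => U_dot'.
    by rewrite -U_dot' VK aF -(U_dot' x) VK.
  by rewrite -U_dot' VK -aF -(U_dot' _ x) VK.
- by move=> x /=; rewrite form; have := hF (U x); case: U_dot => ->.
Qed.

Lemma rank_one_pullback v x :
  hdot (rank_one (U v) (U x)) (U x) = hdot (rank_one v x) x.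
Proof.
rewrite !rank_oneE; case: U_dot => -> //.
by rewrite -hdotC norm_conjC.
Qed.

(** phi E and its pullback by U are above the same rank-one operators, which
    determine E by [effect_eq_off_hyperplane]. *)
Lemma order_automorphism_conj phi e E : order_automorphism phi ->
  (forall v, hdot v v <= 1 -> hdot v e != 0 -> phi (rank_one v) = rank_one (U v)) ->
  effects E -> hdot (E e) e != 0 -> phi E = U \o E \o V.
Proof.
move=> aphi phiU eE ee; have epE := order_automorphism_effects aphi eE.
have [eG formG] := effects_pullback epE.
suff h : E = V \o phi E \o U.
  by apply/funext => x; have /= -> := congr1 (fun F => F (V x)) h; rewrite !VK.
apply: (effect_eq_off_hyperplane eE eG ee) => v v1 ve.
have ev := effects_rank_one v1.
have eUv : effects (rank_one (U v)).
  by rewrite -phiU//; exact: order_automorphism_effects.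
case: (aphi) => _ o; rewrite o// phiU// !effect_leP//; split=> h x.
  by rewrite /= formG -rank_one_pullback.
by rewrite -[x]VK rank_one_pullback; have := h (V x); rewrite /= formG.
Qed.

End Conjugation.

(** Any unit vector e of the range of D will do: a vector at which the form of D
    vanishes is in the kernel of D, the orthogonal complement of its range. *)
Lemma exists_off_kernel (D : H -> H) : positive_op D -> (exists x, D x != 0) ->
  exists2 e, hdot e e = 1 & forall x, hdot x e != 0 -> hdot (D x) x != 0.
Proof.
move=> [[[lD _] aD] pD] [f f0].
have n0 : `|D f| != 0 by rewrite normr_eq0.
exists (`|D f|^-1 *: D f).
  by rewrite hdotZZ hdot_norm normfV normr_id exprVn mulVf// expf_neq0.
move=> x; apply: contra_neq => Dx.
by rewrite hdotZr -aD (form_null lD aD pD Dx) hdot0l mulr0.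
Qed.

(** Off e^perp, phi and its dual act on rays by the same map, which preserves
    transition probabilities; Wigner's theorem turns it into U. *)
Lemma order_automorphism_wigner phi (q q' : H -> C) (e : H) :
  order_automorphism phi ->
  (forall c v, q (c *: v) = `|c| ^+ 2 * q v) ->
  (forall c v, q' (c *: v) = `|c| ^+ 2 * q' v) ->
  (forall v w, hdot v v <= 1 -> phi (rank_one v) = rank_one w -> q v = q' w) ->
  (forall v w, hdot v v <= 1 -> dual_map phi (rank_one v) = rank_one w -> q v = q' w) ->
  hdot e e = 1 -> (forall x, hdot x e != 0 -> q x != 0) ->
  exists U, [/\ (forall x y, hdot (U x) (U y) = hdot x y) \/
                (forall x y, hdot (U x) (U y) = hdot y x),
    (forall y, exists x, U x = y) &
    forall v, hdot v v <= 1 -> hdot v e != 0 ->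
      phi (rank_one v) = rank_one (U v) /\ dual_map phi (rank_one v) = rank_one (U v)].
Proof.
move=> aphi qZ q'Z qq' qd e1 off; have adual := order_automorphism_dual aphi.
have /choice[r rP] : forall x, exists w, hdot x x = 1 ->
    hdot w w = 1 /\ phi (rank_one x) = rank_one w.
  move=> x; have [x1|x1] := eqVneq (hdot x x) 1; last first.
    by exists x => /eqP; rewrite (negbTE x1).
  by have [w w1 wE] := order_automorphism_unit aphi x1; exists w.
have trans x y : hdot x x = 1 -> hdot y y = 1 -> q x != 0 -> q y != 0 ->
    forall y', hdot y' y' = 1 -> dual_map phi (rank_one y) = rank_one y' ->
    `|hdot (r x) y'| = `|hdot x y|.
  move=> x1 y1 qx qy y' y'1 yy'; have [rx1 rxE] := rP _ x1.
  exact: (order_automorphism_transition aphi qZ q'Z qq' qd).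
(* the transition probability of x with itself is 1, so phi and its dual move x
   alike *)
have dualr x : hdot x x = 1 -> q x != 0 -> dual_map phi (rank_one x) = rank_one (r x).
  move=> x1 qx; have [y' y'1 yE] := order_automorphism_unit adual x1.
  have [rx1 _] := rP _ x1.
  have := trans _ _ x1 x1 qx qx _ y'1 yE; rewrite x1 normr1 => rxy.
  have [c c1 cE] : exists2 c, `|c| = 1 & r x = c *: y'.
    by apply: cauchy_schwarz_eq; rewrite rx1.
  by rewrite yE cE rank_one_scale.
have {}trans x y : hdot x x = 1 -> hdot y y = 1 -> q x != 0 -> q y != 0 ->
    `|hdot (r x) (r y)| = `|hdot x y|.
  by move=> x1 y1 qx qy; have [ry1 _] := rP _ y1; apply: trans => //; exact: dualr.
(* extend r from unit vectors to all vectors by homogeneity *)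
pose hat x := `|x|^-1 *: x; pose p x := `|x| *: r (hat x).
have nz x : hdot x e != 0 -> `|x| != 0.
  by apply: contra_neq => /eqP; rewrite normr_eq0 => /eqP ->; rewrite hdot0l.
have hat1 x : `|x| != 0 -> hdot (hat x) (hat x) = 1.
  by move=> n0; rewrite hdotZZ hdot_norm normfV normr_id exprVn mulVf// expf_neq0.
have hatK x : `|x| != 0 -> x = `|x| *: hat x.
  by move=> n0; rewrite scalerA divff// scale1r.
have hat_unit x : hdot x x = 1 -> hat x = x.
  move=> x1; suff n1 : `|x| = 1 by rewrite /hat n1 invr1 scale1r.
  by apply/eqP; rewrite -(@eqrXn2 _ 2)// -hdot_norm x1 expr1n.
have qhat x : hdot x e != 0 -> q (hat x) != 0.
  by move=> xe; apply: off; rewrite hdotZl mulf_neq0// invr_eq0 nz.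
have pe : p e = r e.
  by rewrite /p hat_unit// -[RHS]scale1r; congr (_ *: _); apply/eqP;
    rewrite -(@eqrXn2 _ 2)// -hdot_norm e1 expr1n.
have qe : q e != 0 by apply: off; rewrite e1 oner_neq0.
have [|y|U [U_dot Uonto Up]] := @wigner_off_hyperplane _ _ e p e1.
- move=> x y xe ye; rewrite hdotZl hdotZr !normrM norm_conjC trans ?hat1 ?nz ?qhat//.
  have xy : hdot x y = `|x| * (`|y|^* * hdot (hat x) (hat y)).
    by rewrite -hdotZr -hdotZl -!hatK ?nz.
  by rewrite [in RHS]xy !normrM norm_conjC.
- rewrite pe => ye.
  have yn : `|y| != 0.
    by apply: contra_neq ye => /eqP; rewrite normr_eq0 => /eqP ->; rewrite hdot0l.
  have [x x1 xE] := order_automorphism_unit_onto aphi (hat1 _ yn).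
  have [re1 _] := rP _ e1.
  (* phi preserves orthogonality, being the order relation to a complement *)
  have xe : hdot x e != 0.
    apply: contra_neq ye => xe.
    suff /eqP : hdot (hat y) (r e) = 0.
      by rewrite hdotZl mulf_eq0 invr_eq0 (negbTE yn) => /eqP.
    apply/(rank_one_le_compl_orth (hat1 _ yn) re1).
    have eff z : hdot z z = 1 -> effects (rank_one z).
      by move=> z1; apply: effects_rank_one; rewrite z1.
    have effc z : hdot z z = 1 -> effects (effect_compl (rank_one z)).
      by move=> z1; apply/effects_compl/eff.
    apply/effect_leP; [exact/eff/hat1|exact: effc|].
    rewrite -xE -dualr// /dual_map effect_complK; case: (aphi) => _ o.
    rewrite -o; [|exact: eff|exact: effc].
    apply/effect_leP; [exact: eff|exact: effc|].
    exact/(rank_one_le_compl_orth x1 e1).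
  exists x => //; have [rx1 rxE] := rP _ x1.
  have [c c1 cE] : exists2 c, `|c| <= 1 & hat y = c *: r x.
    by apply: rank_one_leP => z; rewrite -xE rxE.
  exists (`|y| * c / `|x|).
  by rewrite /p hat_unit// scalerA divfK ?nz// -scalerA -cE -hatK.
exists U; split=> // v v1 ve.
have vn := nz _ ve; have [rv1 rvE] := rP _ (hat1 _ vn).
have v1' : `| `|v| | <= 1 by rewrite normr_id -(@expr_le1 _ 2)// -hdot_norm.
have [c c1 UE] := Up _ ve.
have UE' : rank_one (U v) = rank_one (`|v| *: r (hat v)).
  by rewrite UE rank_one_scale.
have -> : rank_one v = rank_one (`|v| *: hat v) by rewrite -hatK.
rewrite UE'; split.
  by apply: (order_automorphism_scale aphi qZ q'Z qq') => //; [exact: hat1|exact: qhat].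
apply: (order_automorphism_scale adual qZ q'Z qd) => //; first exact: hat1.
- by apply: dualr; [exact: hat1|exact: qhat].
- exact: qhat.
Qed.

End Conclusion.

(** * The theorem *)

Theorem theorem1 (R : realType) (H : hilbertType (complexes R))
  (phi : (H -> H) -> (H -> H))
  (phi_bij : set_bij effects effects phi)
  (phi_order : forall E F : H -> H, effects E -> effects F ->
     (op_le E F <-> op_le (phi E) (phi F)))
  (phi_trace : exists D D' : H -> H, [/\ state D, state D' &
     forall E : H -> H, effects E ->
       trace (phi E \o D') = trace (E \o D)]) :
  exists U V : H -> H,
    (unitary_with_adjoint U V \/ antiunitary_with_adjoint U V) /\
    (forall E : H -> H, effects E -> phi E = U \o E \o V).
Proof.
case: phi_trace => D [D' [sD sD' phi_tr]].
have aphi : order_automorphism phi by split.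
have pos (T : H -> H) : state T -> positive_op T by case.
have [[[lD _] aD] _] := pos _ sD; have [[[lD' _] aD'] _] := pos _ sD'.
have D1 := state_has_trace1 sD; have D'1 := state_has_trace1 sD'.
(* otherwise D would have trace 0 *)
have [x Dx] : exists x, D x != 0.
  apply: contrapT => /forallNP D0.
  have trD : trace D = 1 by case: sD.
  have D_0 : rank_one 0 \o D = D.
    apply/funext => y; rewrite /= /rank_one scaler0.
    by apply/esym/eqP/negPn/negP/D0.
  have := traceE (@has_trace_rank_one _ _ D 0 aD).
  by rewrite D_0 trD hdot0r => /eqP; rewrite oner_eq0.
have [e e1 off] := exists_off_kernel (pos _ sD) (ex_intro _ x Dx).
have qq' v w : hdot v v <= 1 -> phi (rank_one v) = rank_one w ->
    hdot (D v) v = hdot (D' w) w.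
  move=> v1 vw; have := phi_tr _ (effects_rank_one v1).
  by rewrite vw !(traceE (has_trace_rank_one _))// => ->.
have qd v w : hdot v v <= 1 -> dual_map phi (rank_one v) = rank_one w ->
    hdot (D v) v = hdot (D' w) w.
  move=> v1 vw; have := phi_tr _ (effects_compl (effects_rank_one v1)).
  rewrite -[phi _]effect_complK -/(dual_map phi _) vw.
  by rewrite !(traceE (has_trace_compl_rank_one _ _))// => /addrI/oppr_inj.
have [U [U_dot Uonto phiU]] := order_automorphism_wigner aphi
  (fun c v => formZ c v lD) (fun c v => formZ c v lD') qq' qd e1 off.
have [V UV] : exists V, unitary_with_adjoint U V \/ antiunitary_with_adjoint U V.
  case: U_dot => U_dot.
    by have [V ?] := onto_isometry_unitary U_dot Uonto; exists V; left.
  by have [V ?] := onto_conj_isometry_antiunitary U_dot Uonto; exists V; right.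
have VK : cancel V U by case: UV => -[].
exists U, V; split=> // E eE.
(* E and its complement cannot both vanish at e, so phi or its dual applies *)
have [ee|ee] := eqVneq (hdot (E e) e) 0; last first.
  by apply: (order_automorphism_conj U_dot VK aphi _ eE ee) => v v1 /(phiU _ v1)[].
have eE' := effects_compl eE.
have ee' : hdot (effect_compl E e) e != 0.
  by rewrite hdotBl ee subr0 e1 oner_neq0.
have h : dual_map phi (effect_compl E) = U \o effect_compl E \o V.
  apply: (order_automorphism_conj U_dot VK (order_automorphism_dual aphi) _ eE' ee').
  by move=> v v1 /(phiU _ v1)[].
rewrite -[phi E]effect_complK -{1}[E]effect_complK -/(dual_map phi _) h.
have UB y z : U (y - z) = U y - U z.
  rewrite [y - z]addrC -[- z]scaleN1r; case: U_dot => U_dot.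
    by rewrite (isometry_linear _ _ _ U_dot) scaleN1r addrC.
  by rewrite (conj_isometry_linear _ _ _ U_dot) rmorphN1 scaleN1r addrC.
by apply/funext => y; rewrite /= /effect_compl /= UB VK subKr.
Qed.
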